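(* Let $n\ge 1$, let $a_k(t)$, $k=1,\dots,n$, be real valued locally integrable functions on $(-\infty;+\infty)$, let $h_k$, $k=1,\dots,n$, be real constants, and let $a_k^0$, $k=1,\dots,n$, be real constants with $|a_k(t)|\le a_k^0$ for $t\in(-\infty;+\infty)$, $k=1,\dots,n$. Suppose that the transcendental equation $$\lambda^2=\sum_{k=1}^n a_k^0 e^{h_k\lambda}$$ (in the real unknown $\lambda$) has both a negative and a positive solution. Then for all $\gamma_0,t_0\in(-\infty;+\infty)$ the equation $$\phi''(t)+\sum_{k=1}^n a_k(t)\phi(t+h_k)=0,\qquad t\in(-\infty;+\infty),$$ has a solution $\phi_0(t)$ on $(-\infty;+\infty)$ satisfying $\phi_0(t_0)=\gamma_0$, $\phi_0'(t_0)=0$.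
   Context: A solution of the equation $\phi''(t)+\sum_{k=1}^n a_k(t)\phi(t+h_k)=0$ on $(-\infty;+\infty)$ is a real valued continuous function $\phi$ on $(-\infty;+\infty)$ such that $\phi'$ is absolutely continuous (on every compact interval) and $\phi$ satisfies the equation almost everywhere on $(-\infty;+\infty)$. Functional inequalities are understood to hold almost everywhere. *)

(* Defs.v *)
From HB Require Import structures.
From mathcomp Require Export all_boot all_order all_algebra.
From mathcomp Require Export all_classical all_reals all_analysis.
Export Order.TTheory GRing.Theory Num.Theory.
Export numFieldNormedType.Exports.

Set Implicit Arguments.
Unset Strict Implicit.
Unset Printing Implicit Defensive.

Local Open Scope classical_set_scope.
Local Open Scope ring_scope.

(* The library's [locally_integrable] refers to the Borel sigma-algebra.  Here
   integrability is with respect to the completed Lebesgue measure, so that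
   every Lebesgue measurable function is allowed. *)
Definition locally_lebesgue_integrable (R : realType) (f : R -> R) : Prop :=
  forall K : set R, compact K ->
    (@completed_lebesgue_measure R).-integrable K (EFin \o f).

Definition absolutely_continuous_on (R : realType) (a b : R) (f : R -> R) :
    Prop :=
  forall e : R, 0 < e -> exists2 d : R, 0 < d &
    forall (m : nat) (x y : 'I_m -> R),
      (forall i, a <= x i /\ x i <= y i /\ y i <= b) ->
      trivIset setT (fun i => `]x i, y i[%classic) ->
      \sum_(i < m) (y i - x i) < d ->
      \sum_(i < m) `|f (y i) - f (x i)| < e.

(* Solutions of phi''(t) + \sum_k a_k(t) phi(t + h_k) = 0.  Since [derive1] is
   total, differentiability is required explicitly wherever a derivative is
   used.  Almost everywhere for [lebesgue_measure] means outside a subset of a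
   Borel null set, that is, outside a Lebesgue null set. *)
Definition is_solution (R : realType) (n : nat) (a : 'I_n -> R -> R)
    (h : 'I_n -> R) (phi : R -> R) : Prop :=
  [/\ continuous phi,
      (forall t, derivable phi t 1),
      (forall b c : R, b <= c -> absolutely_continuous_on b c (derive1 phi)) &
      {ae @lebesgue_measure R, forall t,
        derivable (derive1 phi) t 1 /\
        derive1 (derive1 phi) t + \sum_(k < n) a k t * phi (t + h k) = 0}].

(* Main.v *)
Require Import Defs.
From mathcomp Require Import lra ring.
From mathcomp Require Import measurable_realfun.

Set Implicit Arguments.
Unset Strict Implicit.
Unset Printing Implicit Defensive.

Local Open Scope classical_set_scope.
Local Open Scope ring_scope.

(** The equation with data [phi t0 = gamma0], [phi' t0 = 0] is the integral
equation [phi = gamma0 + J (G phi)], where [G phi t] is the delayed sum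
[\sum_k - a_k t * phi (t + h_k)] and [J f] is the solution of [y'' = f] with
[y t0 = y' t0 = 0].  The operator [J] is monotone on both sides of [t0], because
the sign of [t - t0] enters twice ([primitive2_le]).  Hence
[|J (G phi)| <= J (A u)] as soon as [|phi| <= u], where [A] is the delayed sum
with the constants [a0_k].

The two roots [m < 0 < l] of the transcendental equation provide a majorant.
Both exponentials [expR (l * (t - t0))] and [expR (m * (t - t0))] solve
[y'' = A y], and so does any combination [W] of the two.  The conditions
[W t0 = |gamma0|] and [W' t0 = 0] give them weights in the ratio [- m : l],
which are nonnegative because the roots have opposite signs; so [W >= 0] and
[W = |gamma0| + J (A W)] ([exponential_majorant]).

The map [phi |-> gamma0 + J (G phi)] need not be a contraction for the norm
weighted by [W], so the fixed point comes from a domination argument.  Let [x_N]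
be the Picard iterates starting from the constant [gamma0], and [u_N] those of
[u |-> |gamma0| + J (A u)] starting from [|gamma0|].  By monotonicity, [|x_N|]
is at most [u_N], which is at most [W], and [|x_(N+1) - x_N|] is at most
[u_(N+1) - u_N].  So [x_N] converges pointwise, and dominated convergence,
applied once for each of the two integrations in [J], passes to the limit in
the recursion ([delay_integral_equation_solution]).

The coefficients are only Lebesgue measurable, while the differentiation and
convergence theorems are used for Borel functions; a Lebesgue measurable
function agrees with a Borel one off a null set ([bounded_borel_representative]),
and altering the coefficients on a null set does not affect the equation. *)

(** * Borel representatives of Lebesgue measurable functions *)

Lemma completed_measurable_set (R : realType)
    (E : set (caratheodory_type ((@wlength R idfun)^*)%mu)) :
  measurable E ->
  exists B N : set R, [/\ measurable B, (@lebesgue_measure R).-negligible N &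
    E = B `|` N].
Proof.
move=> mE.
have : (completed_algebra_gen (@lebesgue_measure R)) E.
  by rewrite -g_sigma_completed_algebra_genE completed_caratheodory_measurable.
by move=> [B mB [N nN <-]]; exists B, N.
Qed.

(** Each superlevel set of [f] at a rational level is Borel up to a null set,
and the countably many exceptional sets lie in one Borel null set [N]; off [N]
every superlevel set of [f] is a countable union of Borel sets. *)
Lemma locally_lebesgue_integrable_borel (R : realType) (f : R -> R) :
  locally_lebesgue_integrable f ->
  exists N : set R, [/\ measurable N, (@lebesgue_measure R) N = 0%E &
    measurable_fun [set: R] (f \_ (~` N))].
Proof.
move=> lf.
pose cT := caratheodory_type ((@wlength R idfun)^*)%mu.
(* Local integrability gives measurability on compact sets only. *)
have mf : measurable_fun ([set: cT] : set cT) (f : cT -> R).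
  have -> : [set: cT] = \bigcup_n ([set` `[- n%:R, n%:R : R]] : set cT).
    apply/seteqP; split=> // x _.
    exists (Num.truncn `|(x : R)|).+1 => //=.
    by rewrite in_itv/= -ler_norml ltW// truncnS_gt.
  apply/measurable_fun_bigcup => n.
    apply: sub_caratheodory; exact: (@measurable_itv R `[- n%:R, n%:R]).
  have /lf/measurable_int/measurable_EFinP := @segment_compact R (- n%:R) n%:R.
  exact.
have mE (q : R) : measurable (f @^-1` `]q, +oo[ : set cT).
  by rewrite -[X in measurable X]setTI; apply: mf.
have {mE} /choice[BN BNP] (q : rat) : exists BN : set R * set R,
    [/\ measurable BN.1, (@lebesgue_measure R).-negligible BN.2 &
    f @^-1` `]ratr q, +oo[ = BN.1 `|` BN.2].
  by have [B [N [? ? ?]]] := completed_measurable_set (mE (ratr q)); exists (B, N).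
have : (@lebesgue_measure R).-negligible
    (\bigcup_n (if unpickle n is Some q then (BN q).2 else set0)).
  apply: negligible_bigcup => n; case: unpickle => [q|].
    by case: (BNP q).
  exact: negligible_set0.
move=> [N [mN N0 BNN]]; exists N; split => //.
have mCN : measurable (~` N : set R) by exact: measurableC.
apply/(measurable_restrictT _ mCN) => //.
apply: (measurability _ (RGenOInfty.measurableE R)).
move=> _ [_ [a ->] <-]; rewrite preimage_itvoy.
rewrite [X in measurable X](_ : _ =
    \bigcup_(q : rat) if a < ratr q then ~` N `&` (BN q).1 else set0).
  apply: bigcupT_measurable_rat => q; case: ifP => // _.
  by apply: measurableI => //; case: (BNP q).
apply/seteqP; split => x /=.
  move=> [Nx /rat_in_itvoo[q /itvP qa]].
  exists q => //; rewrite qa; split => //.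
  have [_ _ /seteqP[/(_ x)]] := BNP q.
  rewrite /= in_itv/= andbT qa => /(_ isT)[//|BNx] _.
  exfalso; apply: Nx; apply: BNN; exists (pickle q); first exact: I.
  by rewrite pickleK.
move=> [q _]; case: ifP => // aq [Nx Bx]; split => //.
have [_ _ /seteqP[_ /(_ x)]] := BNP q.
by rewrite /= in_itv/= andbT => /(_ (or_introl Bx)); exact: lt_trans.
Qed.

Lemma bounded_borel_representative (R : realType) (f : R -> R) (C : R) :
  locally_lebesgue_integrable f ->
  {ae @lebesgue_measure R, forall x, `|f x| <= C} ->
  exists g : R -> R, [/\ measurable_fun [set: R] g, (forall x, `|g x| <= C) &
    {ae @lebesgue_measure R, forall x, f x = g x}].
Proof.
move=> /locally_lebesgue_integrable_borel[N [mN N0 mfN]] [M [mM M0 fCM]].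
(* The bound holds somewhere since the line is not a null set; [g] vanishes on
   the exceptional set, so [0 <= C] is what the bound says there. *)
have C0 : 0 <= C.
  have [x Mx] : exists x, ~ M x.
    apply/existsNP => MT; have /seteqP MR : (M `<=` setT) /\ (setT `<=` M).
      by split => // x _; exact: MT.
    have := lebesgue_measure_itv (`]-oo, +oo[ : interval R).
    by rewrite /= set_itvNyy -MR M0.
  apply: le_trans (normr_ge0 (f x)) _; apply: contra_notT Mx => fx.
  by apply: fCM; exact/negP.
have mCM : measurable (~` M : set R) by exact: measurableC.
exists ((f \_ (~` N)) \_ (~` M)); split.
- by apply/(measurable_restrictT _ mCM); exact: measurable_funTS.
- move=> x; rewrite !patchE.
  case: ifPn => [xM|_]; last by rewrite normr0.
  case: ifPn => [_|_]; last by rewrite normr0.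
  move: xM; rewrite inE/= => xM.
  by apply: contra_notT xM => fx; apply: fCM; exact/negP.
exists (N `|` M); split; first exact: measurableU.
  by rewrite measureU0.
move=> x /= fgx; apply: contrapT => /not_orP[Nx Mx]; apply: fgx.
by rewrite !patchE !mem_set.
Qed.

(** * Locally bounded Borel functions *)

(** A class stable under products, shifts, integration and dominated limits, and
contained in the integrable functions of every compact interval. *)
Definition locally_bounded_borel (R : realType) (f : R -> R) : Prop :=
  measurable_fun [set: R] f /\
  forall A : R, exists C : R, forall x, `|x| <= A -> `|f x| <= C.

Section locally_bounded_borel.
Context {R : realType}.
Notation mu := (@lebesgue_measure R).
Notation lbb := (@locally_bounded_borel R).
Implicit Types (f g : R -> R) (a b c x t : R).

Lemma lbb_itv f : lbb f -> forall a b,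
  exists C, forall x, a <= x <= b -> `|f x| <= C.
Proof.
move=> [_ bf] a b; have [C CP] := bf (`|a| + `|b|).
exists C => x /andP[ax xb]; apply: CP.
have := ler_norm (- a); have := ler_norm b; have := normr_ge0 a.
have := normr_ge0 b; rewrite normrN ler_norml => *; lra.
Qed.

Lemma continuous_lbb f : continuous f -> lbb f.
Proof.
move=> cf; split; first exact: continuous_measurable_fun.
move=> A; have /compact_bounded[M [_ MP]] : compact (f @` `[- A, A]).
  by apply: continuous_compact (@segment_compact _ _ _); exact: continuous_subspaceT.
exists (M + 1) => x xA; apply: (MP (M + 1)); first by rewrite ltrDl.
by exists x => //; rewrite /= in_itv/= -ler_norml.
Qed.

Lemma cst_lbb (r : R) : lbb (cst r).
Proof. by apply: continuous_lbb => x; exact: cvg_cst. Qed.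

Lemma lbbB f g : lbb f -> lbb g -> lbb (f \- g).
Proof.
move=> [mf bf] [mg bg]; split; first exact: measurable_funB.
move=> A; have [C CP] := bf A; have [C' CP'] := bg A.
exists (C + C') => x xA; apply: le_trans (ler_normB _ _) _.
by apply: lerD; [exact: CP|exact: CP'].
Qed.

Lemma lbbD f g : lbb f -> lbb g -> lbb (f \+ g).
Proof.
move=> [mf bf] [mg bg]; split; first exact: measurable_funD.
move=> A; have [C CP] := bf A; have [C' CP'] := bg A.
exists (C + C') => x xA; apply: le_trans (ler_normD _ _) _.
by apply: lerD; [exact: CP|exact: CP'].
Qed.

Lemma lbb_norm f : lbb f -> lbb (fun x => `|f x|).
Proof.
move=> [mf bf]; split; first exact: measurableT_comp.
by move=> A; have [C CP] := bf A; exists C => x xA; rewrite normr_id CP.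
Qed.

Lemma lbbM f g : lbb f -> lbb g -> lbb (f \* g).
Proof.
move=> [mf bf] [mg bg]; split; first exact: measurable_funM.
move=> A; have [C CP] := bf A; have [C' CP'] := bg A.
exists (C * C') => x xA; rewrite normrM.
by apply: ler_pM => //; [exact: CP|exact: CP'].
Qed.

Lemma lbb_sum (n : nat) (F : 'I_n -> R -> R) :
  (forall k, lbb (F k)) -> lbb (fun x => \sum_(k < n) F k x).
Proof.
move=> lF; split; first by apply: measurable_sum => k; case: (lF k).
move=> A; have /choice[C CP] k := (lF k).2 A.
exists (\sum_(k < n) C k) => x xA; apply: le_trans (ler_norm_sum _ _ _) _.
by apply: ler_sum => k _; exact: CP.
Qed.

Lemma lbb_shift f h : lbb f -> lbb (fun x => f (x + h)).
Proof.
move=> [mf bf]; split.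
  apply: (measurableT_comp mf).
  by apply: continuous_measurable_fun => x; apply: cvgD; [exact: cvg_id|exact: cvg_cst].
move=> A; have [C CP] := bf (A + `|h|); exists C => x xA; apply: CP.
by apply: le_trans (ler_normD _ _) _; rewrite lerD2r.
Qed.

Lemma lbb_dominated f g : measurable_fun setT f -> lbb g ->
  (forall x, `|f x| <= g x) -> lbb f.
Proof.
move=> mf [_ bg] fg; split => // A; have [C CP] := bg A; exists C => x xA.
exact: le_trans (le_trans (fg x) (ler_norm _)) (CP _ xA).
Qed.

Lemma lbb_integrable f a b : lbb f -> mu.-integrable `[a, b] (EFin \o f).
Proof.
move=> lf; apply: measurable_bounded_integrable => //.
- by rewrite /= lebesgue_measure_itv; case: ifP => _; rewrite ?ltry// -EFinB ltry.
- by apply: measurable_funTS; case: lf.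
have [C CP] := lbb_itv lf a b.
exists C; split; first by rewrite num_real.
move=> M CM x /=; rewrite in_itv/= => /CP xC.
exact: le_trans xC (ltW CM).
Qed.

End locally_bounded_borel.

(** * Oriented integrals *)

(** The oriented integral of [f] from [c] to [t]: one of the two intervals is
empty or a point. *)
Definition primitive (R : realType) (c : R) (f : R -> R) (t : R) : R :=
  \int[@lebesgue_measure R]_(s in `[c, t]) f s -
  \int[@lebesgue_measure R]_(s in `[t, c]) f s.

Section primitive.
Context {R : realType}.
Notation mu := (@lebesgue_measure R).
Notation lbb := (@locally_bounded_borel R).
Implicit Types (f g : R -> R) (a b c x t : R).

Lemma Rintegral_itv_cat f a b c : lbb f -> a <= b -> b <= c ->
  \int[mu]_(x in `[a, c]) f x =
  \int[mu]_(x in `[a, b]) f x + \int[mu]_(x in `[b, c]) f x.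
Proof.
move=> lf ab bc; have := @Rintegral_itvB R f (BLeft a) (BRight c) b
  (lbb_integrable a c lf).
rewrite !bnd_simp => /(_ ab bc) /eqP; rewrite subr_eq => /eqP ->.
rewrite addrC Rintegral_itv_obnd_cbnd//.
apply: integrableS (lbb_integrable b c lf) => //.
by apply: subset_itvr; rewrite bnd_simp.
Qed.

Lemma Rintegral_itv_gt f a b : b <= a -> \int[mu]_(x in `[a, b]) f x = 0.
Proof.
rewrite le_eqVlt => /predU1P[->|ba]; first by rewrite set_itv1 Rintegral_set1.
by rewrite set_itv_ge ?Rintegral_set0// bnd_simp -ltNge.
Qed.

Lemma primitive_ge c f t : c <= t ->
  primitive c f t = \int[mu]_(s in `[c, t]) f s.
Proof. by move=> ct; rewrite /primitive [X in _ - X]Rintegral_itv_gt// subr0. Qed.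

Lemma primitive_le c f t : t <= c ->
  primitive c f t = - \int[mu]_(s in `[t, c]) f s.
Proof. by move=> ct; rewrite /primitive Rintegral_itv_gt// sub0r. Qed.

Lemma primitivexx c f : primitive c f c = 0.
Proof. by rewrite primitive_ge// Rintegral_itv_gt. Qed.

Lemma primitiveB_itv c f s t : lbb f -> s <= t ->
  primitive c f t - primitive c f s = \int[mu]_(x in `[s, t]) f x.
Proof.
move=> lf st; have [cs|sc] := leP c s.
  rewrite !primitive_ge ?(le_trans cs)// (Rintegral_itv_cat lf cs st); lra.
have [ct|tc] := leP c t.
  rewrite primitive_ge// primitive_le ?ltW//.
  rewrite (Rintegral_itv_cat lf (ltW sc) ct); lra.
rewrite !primitive_le ?ltW//.
rewrite (Rintegral_itv_cat lf st (ltW tc)); lra.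
Qed.

Lemma Rintegral_itv_le f g a b : lbb f -> lbb g ->
  (forall x, a <= x <= b -> `|f x| <= g x) ->
  `|\int[mu]_(x in `[a, b]) f x| <= \int[mu]_(x in `[a, b]) g x.
Proof.
move=> lf lg fg.
apply: (le_trans (le_normr_Rintegral _ (lbb_integrable _ _ lf))) => //.
apply: le_Rintegral => //.
- exact: (integrable_abse (lbb_integrable a b lf)).
- exact: lbb_integrable.
Qed.

Lemma primitive_lipschitz c f (C : R) s t : lbb f -> s <= t ->
  (forall x, s <= x <= t -> `|f x| <= C) ->
  `|primitive c f t - primitive c f s| <= C * (t - s).
Proof.
move=> lf st fC; rewrite primitiveB_itv//.
have lC := cst_lbb C.
apply: (le_trans (Rintegral_itv_le lf lC fC)).
rewrite Rintegral_cst//= lebesgue_measure_itv/= lte_fin.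
by case: ltP => ts; rewrite //= (le_anti (introT andP (conj st ts))) subrr.
Qed.

Lemma primitive_continuous c f : lbb f -> continuous (primitive c f).
Proof.
move=> lf x; have [C CP] := lbb_itv lf (x - 1) (x + 1).
have C0 : 0 <= C by apply: le_trans (CP x _) => //; apply/andP; split; lra.
have near_x (y : R) : `|x - y| <= 1 ->
    `|primitive c f x - primitive c f y| <= C * `|x - y|.
  rewrite ler_norml => /andP[xy1 xy2]; have [xy|yx] := leP x y.
    rewrite (distrC x) (distrC (primitive c f x)) [`|y - x|]ger0_norm ?subr_ge0//.
    apply: primitive_lipschitz => // z /andP[? ?]; apply: CP.
    by apply/andP; split; lra.
  rewrite [`|x - y|]ger0_norm; last by rewrite subr_ge0 ltW.
  apply: primitive_lipschitz => //; first exact: ltW.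
  by move=> z /andP[? ?]; apply: CP; apply/andP; split; lra.
apply/cvgrPdist_le => e e0; near=> y.
apply: (le_trans (near_x y _)).
  by near: y; apply: cvgr_dist_le => //; exact: cvg_id.
have xye : `|x - y| <= e / (C + 1).
  by near: y; apply: cvgr_dist_le; [exact: cvg_id|rewrite divr_gt0//; lra].
apply: (@le_trans _ _ ((C + 1) * `|x - y|)); first by rewrite ler_wpM2r//; lra.
by rewrite mulrC -ler_pdivlMr//; lra.
Unshelve. all: by end_near. Qed.

Lemma primitive_lbb c f : lbb f -> lbb (primitive c f).
Proof. by move=> lf; exact/continuous_lbb/primitive_continuous. Qed.

Lemma primitive_absolutely_continuous c f a b : lbb f ->
  absolutely_continuous_on a b (primitive c f).
Proof.
move=> lf e e0; have [C CP] := lbb_itv lf a b.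
(* [C] may be negative when [b < a]. *)
pose C' := `|C| + 1; have C'0 : 0 < C' by rewrite ltr_wpDl.
exists (e / C'); first by rewrite divr_gt0.
move=> m x y axyb _ dxy.
apply: (@le_lt_trans _ _ (\sum_(i < m) C' * (y i - x i))); last first.
  by rewrite -mulr_sumr mulrC -ltr_pdivlMr.
apply: ler_sum => i _; have [ax [xy yb]] := axyb i.
apply: primitive_lipschitz => // z /andP[xz zy].
apply: (le_trans (CP z _)); first by apply/andP; split; lra.
by apply: (le_trans (ler_norm _)); rewrite lerDl.
Qed.

(** Near [x] the primitive differs by a constant from the integral over
[[x - 1, y]], to which the one-sided fundamental theorem applies, wherever [x]
lies with respect to [c]. *)
Lemma is_derive_primitive_lebesgue_pt c f x : lbb f -> lebesgue_pt f x ->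
  is_derive x 1 (primitive c f) (f x).
Proof.
move=> lf fx; pose F y := \int[mu]_(s in `[x - 1, y]) f s.
have dF : is_derive x 1 F (f x).
  have [] := @FTC1_lebesgue_pt R f (BLeft (x - 1)) x (x + 1) _ _ _ fx.
  - by rewrite ltrDl.
  - exact: lbb_integrable.
  - by rewrite /= lte_fin gtrBl.
  by rewrite derive1E; exact: DeriveDef.
apply: (@near_eq_is_derive _ _ _ (fun y => primitive c f (x - 1) + F y)).
  near=> y; rewrite /F -(primitiveB_itv c lf) ?subrKC//.
  by apply: ltW; near: y; apply: lt_nbhsr; rewrite gtrBl.
by rewrite -[f x]add0r; apply: is_deriveD; exact: is_derive_cst.
Unshelve. all: by end_near. Qed.

Lemma is_derive_primitive_ae c f : lbb f ->
  {ae mu, forall x, is_derive x 1 (primitive c f) (f x)}.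
Proof.
move=> lf.
have /lebesgue_differentiation : locally_integrable [set: R] f.
  split; [by case: lf|exact: openT|move=> K _ cK].
  have [M [_ MP]] := compact_bounded cK.
  have /integrableP[_] := @lbb_integrable R f (- (M + 1)) (M + 1) lf.
  apply: le_lt_trans; apply: ge0_subset_integral => //.
  - exact: compact_measurable.
  - by apply/measurable_EFinP/measurableT_comp => //; apply: measurable_funTS; case: lf.
  - by move=> x Kx /=; rewrite in_itv/= -ler_norml; apply: MP => //; rewrite ltrDl.
apply: filterS; first exact: (ae_filter_ringOfSetsType mu).
by move=> x; exact: is_derive_primitive_lebesgue_pt.
Qed.

Lemma is_derive_primitive_continuous c f x : continuous f ->
  is_derive x 1 (primitive c f) (f x).
Proof.
move=> cf; apply: is_derive_primitive_lebesgue_pt; first exact: continuous_lbb.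
apply: (@continuous_lebesgue_pt _ _ _ setT) => //.
- by split => //; exact: openT.
- exact: continuous_measurable_fun.
- exact: cf.
Qed.

(** The difference of two antiderivatives of [f] has derivative zero. *)
Lemma primitive_is_derive c f (F : R -> R) t : continuous f ->
  (forall x, is_derive x 1 F (f x)) -> primitive c f t = F t - F c.
Proof.
move=> cf dF; apply/eqP; rewrite eq_sym subr_eq addrC -subr_eq; apply/eqP.
rewrite -[RHS]subr0 -(primitivexx c f).
apply: (@is_derive_0_is_cst R (F - primitive c f) t c) => x.
rewrite -(subrr (f x)); apply: is_deriveB.
exact: is_derive_primitive_continuous.
Qed.

Lemma primitiveB c f g t : lbb f -> lbb g ->
  primitive c (f \- g) t = primitive c f t - primitive c g t.
Proof.
move=> lf lg; rewrite /primitive !RintegralB//; try exact: lbb_integrable.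
lra.
Qed.

Lemma primitive_cvg c (f_ : (R -> R)^nat) f g t :
  (forall n, lbb (f_ n)) -> lbb f -> lbb g ->
  (forall n x, `|f_ n x| <= g x) -> (forall x, f_ ^~ x @ \oo --> f x) ->
  primitive c (f_ n) t @[n --> \oo] --> primitive c f t.
Proof.
move=> lf_ lf lg f_g f_f.
have cvg_itv a b : \int[mu]_(x in `[a, b]) f_ n x @[n --> \oo] -->
    \int[mu]_(x in `[a, b]) f x.
  apply: fine_cvg; rewrite fineK; last first.
    by apply: integrable_fin_num => //; exact: lbb_integrable.
  have [] // := @dominated_convergence _ _ _ mu `[a, b]%classic _
    (fun n => EFin \o f_ n) (EFin \o f) (EFin \o g).
  - by move=> n; apply/measurable_EFinP/measurable_funTS; case: (lf_ n).
  - by apply/measurable_EFinP/measurable_funTS; case: lf.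
  - by apply: aeW => x _; apply: cvg_EFin; [exact: nearW|exact: f_f].
  - exact: lbb_integrable.
  - by apply: aeW => x n _; rewrite /= lee_fin.
by apply: cvgB; exact: cvg_itv.
Qed.

Lemma primitive_le_norm c f g t : lbb f -> lbb g ->
  (forall x, `|f x| <= g x) -> `|primitive c f t| <= `|primitive c g t|.
Proof.
move=> lf lg fg; have [ct|/ltW tc] := leP c t.
  rewrite !(primitive_ge _ ct); apply: le_trans (ler_norm _).
  by apply: Rintegral_itv_le => // x _.
rewrite !(primitive_le _ tc) !normrN; apply: le_trans (ler_norm _).
by apply: Rintegral_itv_le => // x _.
Qed.

(** To the left of [c] a single oriented integral reverses inequalities, and the
second one restores the order. *)
Lemma primitive2_le c f g t : lbb f -> lbb g -> (forall x, `|f x| <= g x) ->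
  `|primitive c (primitive c f) t| <= primitive c (primitive c g) t.
Proof.
move=> lf lg fg; have lF := primitive_lbb c lf; have lG := primitive_lbb c lg.
have [ct|tc] := leP c t.
  rewrite !(primitive_ge _ ct); apply: Rintegral_itv_le => // s /andP[cs _].
  by rewrite !primitive_ge//; exact: Rintegral_itv_le.
rewrite !(primitive_le _ (ltW tc)) normrN.
have -> : - (\int[mu]_(s in `[t, c]) primitive c g s) =
    \int[mu]_(s in `[t, c]) (- 1 * primitive c g s).
  by rewrite RintegralZl ?mulN1r//; exact: lbb_integrable.
apply: Rintegral_itv_le => //.
  by apply: lbbM => //; exact: cst_lbb.
move=> s /andP[_ sc]; rewrite !primitive_le// normrN mulN1r opprK.
exact: Rintegral_itv_le.
Qed.

End primitive.

(** * Delayed sums and Picard iteration *)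

(** Both [u] and [x + u] are nondecreasing and bounded above, so they converge,
and so does their difference. *)
Lemma is_cvg_dominated_increments (R : realType) (x u : R^nat) (B : R) :
  (forall n, `|x n| <= u n) -> (forall n, u n <= B) ->
  (forall n, `|x n.+1 - x n| <= u n.+1 - u n) -> cvgn x.
Proof.
move=> xu uB dxu.
have cu : cvgn u.
  apply: nondecreasing_is_cvgn.
    by apply/nondecreasing_seqP => n; rewrite -subr_ge0 (le_trans _ (dxu n)).
  by exists B => _ [n _ <-].
have cxu : cvgn (x \+ u).
  apply: nondecreasing_is_cvgn.
    apply/nondecreasing_seqP => n /=; have := dxu n.
    by rewrite ler_norml => /andP[? _]; lra.
  exists (B + B) => _ [n _ <-] /=; apply: lerD => //.
  exact: le_trans (ler_norm _) (le_trans (xu n) (uB n)).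
have -> : x = (x \+ u) \- u by apply/funext => n /=; rewrite addrK.
exact: is_cvgB.
Qed.

(** The solution of [y'' = f] with [y c = y' c = 0]. *)
Definition primitive2 (R : realType) (c : R) (f : R -> R) : R -> R :=
  primitive c (primitive c f).

Section primitive2.
Context {R : realType}.
Notation lbb := (@locally_bounded_borel R).
Implicit Types (f g : R -> R) (c t : R).

Lemma primitive2_lbb c f : lbb f -> lbb (primitive2 c f).
Proof. by move=> lf; do 2 apply: primitive_lbb. Qed.

Lemma primitive2B c f g t : lbb f -> lbb g ->
  primitive2 c (f \- g) t = primitive2 c f t - primitive2 c g t.
Proof.
move=> lf lg; rewrite /primitive2.
have -> : primitive c (f \- g) = primitive c f \- primitive c g.
  by apply/funext => s; exact: primitiveB.
by rewrite primitiveB//; exact: primitive_lbb.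
Qed.

End primitive2.

Definition delay_sum (R : realType) (n : nat) (h : 'I_n -> R)
    (b : 'I_n -> R -> R) (phi : R -> R) (t : R) : R :=
  \sum_(k < n) b k t * phi (t + h k).

Section delay_sum.
Context {R : realType} {n : nat}.
Variable h : 'I_n -> R.
Notation lbb := (@locally_bounded_borel R).
Implicit Types (b : 'I_n -> R -> R) (phi psi u : R -> R).

Lemma delay_sum_lbb b phi : (forall k, lbb (b k)) -> lbb phi ->
  lbb (delay_sum h b phi).
Proof.
by move=> lb lphi; apply: lbb_sum => k; apply: lbbM => //; exact: lbb_shift.
Qed.

Lemma delay_sum_le b b' phi u t : (forall k s, `|b k s| <= b' k s) ->
  (forall s, `|phi s| <= u s) -> `|delay_sum h b phi t| <= delay_sum h b' u t.
Proof.
move=> bb' phiu; apply: le_trans (ler_norm_sum _ _ _) _; apply: ler_sum => k _.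
by rewrite normrM; apply: ler_pM.
Qed.

Lemma delay_sumB b phi psi :
  delay_sum h b (phi \- psi) = delay_sum h b phi \- delay_sum h b psi.
Proof.
apply/funext => t; rewrite /delay_sum /= -sumrB.
by apply: eq_bigr => k _; rewrite mulrBr.
Qed.

Lemma primitive2_delay_sum_le c b b' phi u t :
  (forall k, lbb (b k)) -> (forall k, lbb (b' k)) -> lbb phi -> lbb u ->
  (forall k s, `|b k s| <= b' k s) -> (forall s, `|phi s| <= u s) ->
  `|primitive2 c (delay_sum h b phi) t| <= primitive2 c (delay_sum h b' u) t.
Proof.
move=> lb lb' lphi lu bb' phiu; apply: primitive2_le.
- exact: delay_sum_lbb.
- exact: delay_sum_lbb.
- by move=> s; exact: delay_sum_le.
Qed.

End delay_sum.

Fixpoint picard (R : realType) (n : nat) (h : 'I_n -> R) (b : 'I_n -> R -> R)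
    (c gamma : R) (N : nat) : R -> R :=
  if N is N'.+1
  then fun t => gamma + primitive2 c (delay_sum h b (picard h b c gamma N')) t
  else cst gamma.

Section picard.
Context {R : realType} {n : nat}.
Notation lbb := (@locally_bounded_borel R).
Variables (h : 'I_n -> R) (b : 'I_n -> R -> R) (c gamma : R).

Hypothesis b_lbb : forall k, lbb (b k).

Let x := picard h b c gamma.

Lemma picard_lbb N : lbb (x N).
Proof.
elim: N => [|N IH]; first exact: cst_lbb.
by apply: (lbbD (cst_lbb gamma)); exact/primitive2_lbb/delay_sum_lbb.
Qed.

Lemma picard1B t : x 1%N t - x 0%N t = primitive2 c (delay_sum h b (x 0%N)) t.
Proof. by rewrite [x 1%N t]addrC; exact: addrK. Qed.

Lemma picardSB N t :
  x N.+2 t - x N.+1 t = primitive2 c (delay_sum h b (x N.+1 \- x N)) t.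
Proof.
have addBB (y z z' : R) : y + z - (y + z') = z - z' by ring.
rewrite delay_sumB primitive2B; first exact: addBB.
- by apply: delay_sum_lbb => //; exact: picard_lbb.
- by apply: delay_sum_lbb => //; exact: picard_lbb.
Qed.

End picard.

Section majorant.
Context {R : realType} {n : nat}.
Variables (h : 'I_n -> R) (b b' : 'I_n -> R -> R) (c gamma : R) (W : R -> R).
Notation lbb := (@locally_bounded_borel R).

Hypothesis b_lbb : forall k, lbb (b k).
Hypothesis b'_lbb : forall k, lbb (b' k).
Hypothesis b_le : forall k t, `|b k t| <= b' k t.

Hypothesis W_lbb : lbb W.
Hypothesis W_ge0 : forall t, 0 <= W t.
Hypothesis W_eq : forall t,
  W t = `|gamma| + primitive2 c (delay_sum h b' W) t.

Let x := picard h b c gamma.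
Let u := picard h b' c `|gamma|.

Let b'_le k t : `|b' k t| <= b' k t.
Proof. by rewrite ger0_norm// (le_trans (normr_ge0 _) (b_le k t)). Qed.

Let x_lbb N : lbb (x N). Proof. exact: picard_lbb. Qed.
Let u_lbb N : lbb (u N). Proof. exact: picard_lbb. Qed.

Let x_le N t : `|x N t| <= u N t.
Proof.
elim: N t => [|N IH] t; first exact: lexx.
apply: le_trans (ler_normD _ _) _; rewrite lerD2l.
exact: primitive2_delay_sum_le.
Qed.

Let u_le N t : u N t <= W t.
Proof.
rewrite W_eq; elim: N t => [|N IH] t.
  rewrite lerDl; apply: le_trans (normr_ge0 _) _; last first.
    apply: (@primitive2_delay_sum_le _ _ h c b' b' W W) => // s.
    by rewrite ger0_norm.
rewrite lerD2l; apply: le_trans (ler_norm _) _.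
apply: (@primitive2_delay_sum_le _ _ h c b' b' (u N) W) => // s.
by rewrite W_eq ger0_norm// (le_trans (normr_ge0 _) (x_le N s)).
Qed.

Let x_increment N t : `|x N.+1 t - x N t| <= u N.+1 t - u N t.
Proof.
have norm_le_eq (y y' z z' : R) : y = y' -> z = z' -> `|y'| <= z' -> `|y| <= z.
  by move=> -> ->.
elim: N t => [|N IH] t.
  have dx : x 1%N t - x 0%N t = _ := picard1B h b c gamma t.
  have du : u 1%N t - u 0%N t = _ := picard1B h b' c `|gamma| t.
  by apply: (norm_le_eq _ _ _ _ dx du); exact: primitive2_delay_sum_le.
have dx : x N.+2 t - x N.+1 t = _ := picardSB h c gamma b_lbb N t.
have du : u N.+2 t - u N.+1 t = _ := picardSB h c `|gamma| b'_lbb N t.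
apply: (norm_le_eq _ _ _ _ dx du).
apply: primitive2_delay_sum_le.
- exact: b_lbb.
- exact: b'_lbb.
- exact: lbbB.
- exact: lbbB.
- exact: b_le.
- exact: IH.
Qed.

(** The Picard iterates converge pointwise, and the limit passes through the two
integrations.  The dominating functions are [delay_sum h b' W] for the
integrands and the absolute value of its primitive, which is negative to the
left of [c], for their primitives. *)
Lemma delay_integral_equation_solution : exists phi : R -> R,
  lbb phi /\ forall t, phi t = gamma + primitive2 c (delay_sum h b phi) t.
Proof.
pose phi t := lim (x N t @[N --> \oo]).
have cphi t : x N t @[N --> \oo] --> phi t.
  exact: (@is_cvg_dominated_increments _ _ (u ^~ t) (W t)).
have x_leW N t : `|x N t| <= W t by exact: le_trans (x_le N t) (u_le N t).
have phi_lbb : lbb phi.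
  apply: (lbb_dominated _ W_lbb) => [|t].
    by apply: (measurable_fun_cvg (h := x)) => // N; case: (x_lbb N).
  apply: (ler_cvg_to (cvg_norm (cphi t)) (cvg_cst (W t))).
  by apply: nearW => N; exact: x_leW.
exists phi; split; [exact: phi_lbb|move=> t].
have bx_lbb N : lbb (delay_sum h b (x N)) by exact: delay_sum_lbb.
have bphi_lbb : lbb (delay_sum h b phi) by exact: delay_sum_lbb.
have bW_lbb : lbb (delay_sum h b' W) by exact: delay_sum_lbb.
have bx_le N s : `|delay_sum h b (x N) s| <= delay_sum h b' W s.
  exact: delay_sum_le.
have cbx s : delay_sum h b (x N) s @[N --> \oo] --> delay_sum h b phi s.
  apply: cvg_big => [|k _]; first exact: add_continuous.
  by apply: cvgM; [exact: cvg_cst|exact: cphi].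
have cPbx s : primitive c (delay_sum h b (x N)) s @[N --> \oo] -->
    primitive c (delay_sum h b phi) s.
  by apply: (primitive_cvg (g := delay_sum h b' W)).
have cJbx : primitive2 c (delay_sum h b (x N)) t @[N --> \oo] -->
    primitive2 c (delay_sum h b phi) t.
  apply: (primitive_cvg (g := fun s => `|primitive c (delay_sum h b' W) s|)) => //.
  - by move=> N; exact: primitive_lbb.
  - exact: primitive_lbb.
  - exact/lbb_norm/primitive_lbb.
  - by move=> N s; exact: primitive_le_norm.
apply: (@cvg_unique _ (@Rhausdorff R) (x N.+1 t @[N --> \oo])).
  by have := cphi t; rewrite -(cvg_shiftS (x ^~ t)).
by apply: cvgD; [exact: cvg_cst|exact: cJbx].
Qed.

End majorant.

(** * The exponential majorant *)

Section exponential_majorant.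
Context {R : realType} {n : nat}.
Variables (h a0 : 'I_n -> R) (c : R).

Let expc (l t : R) := expR (l * (t - c)).

Let is_derive_expc (p l t : R) :
  is_derive t 1 (fun s => p * expc l s) (p * l * expc l t).
Proof.
have dl : is_derive t 1 (fun s : R => l * (s - c)) l.
  have -> : (fun s : R => l * (s - c)) = l *: (id - cst c).
    by apply/funext => s.
  rewrite -[X in is_derive _ _ _ X]mulr1 -[X in l * X]subr0.
  exact: is_deriveZ.
have de := @is_derive1_comp R expR (fun s => l * (s - c)) t _ _
  (is_derive_expR (l * (t - c))) dl.
have := is_deriveZ p de.
by rewrite -[p *: _]/(p * (expc l t * l)) (mulrC _ l) mulrA.
Qed.

Let is_derive_expc2 (p q l m t : R) : is_derive t 1
  (fun s => p * expc l s + q * expc m s)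
  (p * l * expc l t + q * m * expc m t).
Proof. exact: is_deriveD. Qed.

Let continuous_expc2 (p q l m : R) :
  continuous (fun s => p * expc l s + q * expc m s).
Proof.
move=> t; apply: differentiable_continuous; apply/derivable1_diffP.
exact: (@ex_derive _ _ _ _ _ _ _ (is_derive_expc2 p q l m t)).
Qed.

Let delay_sum_expc2 (p q l m t : R) :
  l ^+ 2 = \sum_(k < n) a0 k * expR (h k * l) ->
  m ^+ 2 = \sum_(k < n) a0 k * expR (h k * m) ->
  delay_sum h (fun k => cst (a0 k)) (fun s => p * expc l s + q * expc m s) t =
    p * l ^+ 2 * expc l t + q * m ^+ 2 * expc m t.
Proof.
have expcD r s : expc r (t + s) = expR (s * r) * expc r t.
  by rewrite /expc -expRD; congr expR; ring.
move=> -> ->; rewrite !mulr_sumr !mulr_suml -big_split/=.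
by apply: eq_bigr => k _; rewrite !expcD /cst; ring.
Qed.

Lemma exponential_majorant (M l m : R) : 0 <= M -> m < 0 -> 0 < l ->
  l ^+ 2 = \sum_(k < n) a0 k * expR (h k * l) ->
  m ^+ 2 = \sum_(k < n) a0 k * expR (h k * m) ->
  exists W : R -> R, [/\ locally_bounded_borel W, forall t, 0 <= W t &
    forall t, W t = M + primitive2 c (delay_sum h (fun k => cst (a0 k)) W) t].
Proof.
move=> M0 m0 l0 lE mE.
have lm : 0 < l - m by lra.
(* The weights solve [p + q = M] and [p * l + q * m = 0]. *)
pose p := - m * M / (l - m); pose q := l * M / (l - m).
have p0 : 0 <= p by apply: divr_ge0; [apply: mulr_ge0|]; lra.
have q0 : 0 <= q by apply: divr_ge0; [apply: mulr_ge0|]; lra.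
exists (fun t => p * expc l t + q * expc m t); split.
- by apply: continuous_lbb; exact: continuous_expc2.
- by move=> t; apply: addr_ge0; exact: mulr_ge0 (expR_ge0 _).
move=> t.
have expcc k : expc k c = 1 by rewrite /expc subrr mulr0 expR0.
have -> : delay_sum h (fun k => cst (a0 k))
    (fun s => p * expc l s + q * expc m s) =
    fun s => p * l * l * expc l s + q * m * m * expc m s.
  by apply/funext => s; rewrite delay_sum_expc2// !expr2 !mulrA.
rewrite /primitive2.
have -> : primitive c (fun s => p * l * l * expc l s + q * m * m * expc m s) =
    fun s => p * l * expc l s + q * m * expc m s.
  apply/funext => s.
  rewrite (primitive_is_derive _ _ (@continuous_expc2 _ _ _ _)
    (is_derive_expc2 (p * l) (q * m) l m)).
  by rewrite !expcc /p /q; field; lra.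
rewrite (primitive_is_derive _ _ (@continuous_expc2 _ _ _ _)
  (is_derive_expc2 p q l m)).
by rewrite !expcc /p /q; field; lra.
Qed.

End exponential_majorant.

(** * Existence of a solution *)

Unset Implicit Arguments.

Theorem theorem2p1 (R : realType) (n : nat) (n_ge1 : (1 <= n)%N)
    (a : 'I_n -> R -> R) (h : 'I_n -> R) (a0 : 'I_n -> R)
    (a_loc_int : forall k, locally_lebesgue_integrable (a k))
    (a_bound : forall k,
       {ae @lebesgue_measure R, forall t : R, `|a k t| <= a0 k})
    (neg_root : exists lambda : R, lambda < 0 /\
       lambda ^+ 2 = \sum_(k < n) a0 k * expR (h k * lambda))
    (pos_root : exists lambda : R, 0 < lambda /\
       lambda ^+ 2 = \sum_(k < n) a0 k * expR (h k * lambda)) :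
  forall gamma0 t0 : R, exists phi0 : R -> R,
    is_solution a h phi0 /\ phi0 t0 = gamma0 /\ derive1 phi0 t0 = 0.
Proof.
move=> gamma c.
have [l [l0 lE]] := pos_root; have [m [m0 mE]] := neg_root.
have [W [lW W0 WE]] := exponential_majorant c (normr_ge0 gamma) m0 l0 lE mE.
have /choice[g /all_and3[mg gle ag]] k :=
  bounded_borel_representative (a_loc_int k) (a_bound k).
pose b k := \- g k.
have mb k : measurable_fun [set: R] (b k) by exact: measurable_funN.
have ble k t : `|b k t| <= a0 k by rewrite normrN.
have b_lbb k : locally_bounded_borel (b k).
  exact: lbb_dominated (mb k) (cst_lbb (a0 k)) (ble k).
have a0_lbb k : locally_bounded_borel (cst (a0 k)) by exact: cst_lbb.
have [phi [lphi phiE]] :=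
  delay_integral_equation_solution b_lbb a0_lbb ble lW W0 WE.
set F := delay_sum h b phi in phiE.
have lF : locally_bounded_borel F by exact: delay_sum_lbb.
have cF := @primitive_continuous _ c _ lF.
have dphi (t : R) : is_derive t 1 phi (primitive c F t).
  have -> : phi = cst gamma + primitive c (primitive c F) by exact/funext.
  rewrite -[X in is_derive _ _ _ X]add0r; apply: is_deriveD.
  exact: is_derive_primitive_continuous.
have phi' : phi^`()%classic = primitive c F.
  by apply/funext => t; rewrite derive1E; exact: derive_val.
exists phi; split; last first.
  by rewrite phi' phiE /primitive2 !primitivexx addr0.
split.
- move=> t; apply: differentiable_continuous; apply/derivable1_diffP.
  exact: ex_derive.
- by move=> t; exact: ex_derive.
- by move=> x y _; rewrite phi'; exact: primitive_absolutely_continuous.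
rewrite phi'.
have ae_filter := ae_filter_ringOfSetsType (@lebesgue_measure R).
have agE : {ae @lebesgue_measure R, forall t, forall k, a k t = g k t}.
  exact: filter_forall.
apply: filterS2 (is_derive_primitive_ae c lF) agE => t dF agt; split.
  exact: ex_derive.
rewrite derive1E (derive_val (is_derive := dF)) -big_split/= big1// => k _.
by rewrite agt -mulrDl addNr mul0r.
Qed.
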